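(* Let $R$ be a real closed field and let $d, n \geq 1$ be integers. For every multi-affine polynomial $P \in R[X_1,\ldots,X_n]$ of degree at most $d$, the number of semi-algebraically connected components of the zero set $Z(P,R^n) = \{x \in R^n \mid P(x) = 0\}$ satisfies $$b_0(Z(P,R^n)) \leq 2^{d-1}.$$ Equivalently, writing $\mathcal{A}_{d,n}$ for the set of multi-affine polynomials of degree at most $d$ in $R[X_1,\ldots,X_n]$, one has $\max_{P \in \mathcal{A}_{d,n}} b_0(Z(P,R^n)) \leq 2^{d-1}$.
   Context: A polynomial $P \in R[X_1,\ldots,X_n]$ is called multi-affine if $\deg_{X_i} P \leq 1$ for every $i$ with $1 \leq i \leq n$. For a closed semi-algebraic set $S \subset R^n$, $b_0(S)$ is the dimension of the zeroth homology of $S$ with rational coefficients, i.e. the number of semi-algebraically connected components of $S$. *)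

(* Defs.v *)
From HB Require Import structures.
From mathcomp Require Import all_boot all_order all_algebra.
From mathcomp Require Import mpoly.
From mathcomp Require Import boolp classical_sets.
From mathcomp Require Import topology_structure num_topology matrix_topology.

Set Implicit Arguments.
Unset Strict Implicit.
Unset Printing Implicit Defensive.

Import Order.TTheory GRing.Theory Num.Theory.
Import numFieldTopology.Exports.

Local Open Scope classical_set_scope.
Local Open Scope ring_scope.

(* R^n is 'rV[R]_n with the product of the order topologies on R (sup-norm
   balls with radius in R), i.e. the Euclidean topology of R^n. *)

Definition zero_set (R : rcfType) (n : nat) (P : {mpoly R[n]}) :
  set 'rV[R]_n := [set x | P.@[x 0] = 0].

Definition partial_deg (R : rcfType) (n : nat) (i : 'I_n) (P : {mpoly R[n]}) :
  nat := (\max_(m <- msupp P) m i)%N.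

Definition multi_affine (R : rcfType) (n : nat) (P : {mpoly R[n]}) : Prop :=
  forall i : 'I_n, (partial_deg i P <= 1)%N.

Inductive semialgebraic (R : rcfType) (n : nat) : set 'rV[R]_n -> Prop :=
| semialgebraic_eq0 (P : {mpoly R[n]}) :
    semialgebraic [set x : 'rV[R]_n | P.@[x 0] = 0]
| semialgebraic_gt0 (P : {mpoly R[n]}) :
    semialgebraic [set x : 'rV[R]_n | 0 < P.@[x 0]]
| semialgebraicU (A B : set 'rV[R]_n) :
    semialgebraic A -> semialgebraic B -> semialgebraic (A `|` B)
| semialgebraicC (A : set 'rV[R]_n) :
    semialgebraic A -> semialgebraic (~` A).

Definition closed_in (T : topologicalType) (S A : set T) : Prop :=
  exists2 F, closed F & A = S `&` F.

Definition open_in (T : topologicalType) (S A : set T) : Prop :=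
  exists2 U, open U & A = S `&` U.

Definition sa_connected (R : rcfType) (n : nat) (S : set 'rV[R]_n) : Prop :=
  ~ exists A B : set 'rV[R]_n,
      [/\ semialgebraic A /\ semialgebraic B,
          A !=set0 /\ B !=set0,
          closed_in S A /\ closed_in S B,
          A `&` B = set0 & S = A `|` B].

Definition sa_component (R : rcfType) (n : nat) (S C : set 'rV[R]_n) : Prop :=
  [/\ C !=set0, semialgebraic C, sa_connected C, closed_in S C & open_in S C].

(* b_0(S) = m, as a relation: S is the disjoint union of m components.  By
   sa_component_eq below, the C i are then all the components of S, and by
   has_b0_uniq m is determined by S. *)
Definition has_b0 (R : rcfType) (n : nat) (S : set 'rV[R]_n) (m : nat) : Prop :=
  exists C : 'I_m -> set 'rV[R]_n,
    [/\ forall i, sa_component S (C i),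
        forall i j, i != j -> C i `&` C j = set0
      & S = \bigcup_i C i].

Lemma semialgebraicI (R : rcfType) (n : nat) (A B : set 'rV[R]_n) :
  semialgebraic A -> semialgebraic B -> semialgebraic (A `&` B).
Proof.
move=> sA sB; rewrite -[A `&` B]setCK setCI.
exact/semialgebraicC/semialgebraicU/semialgebraicC/sB/semialgebraicC.
Qed.

Lemma sa_component_sub (R : rcfType) (n : nat) (S C D : set 'rV[R]_n) :
  sa_component S C -> sa_component S D -> C `&` D !=set0 -> C `<=` D.
Proof.
move=> [_ sC cC [G _ CG] _] [_ sD _ [F clF DF] [U opU DU]] CD0.
have SC : C `<=` S by rewrite CG; exact: subIsetl.
rewrite -setD_eq0; apply: contrapT => /eqP/set0P CD'0; apply: cC.
exists (C `&` D), (C `\` D); split.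
- split; first exact: semialgebraicI.
  by rewrite setDE; apply: semialgebraicI => //; exact: semialgebraicC.
- by split.
- split.
    by exists F => //; rewrite DF setIA (setIidl SC).
  exists (~` U); first exact: open_closedC.
  rewrite setDE DU setCI setIUr (_ : C `&` ~` S = set0) ?set0U//.
  by rewrite -setDE setD_eq0.
- by rewrite setDE setIACA setICr setI0.
- by rewrite setUIDK.
Qed.

Lemma sa_component_eq (R : rcfType) (n : nat) (S C D : set 'rV[R]_n) :
  sa_component S C -> sa_component S D -> C `&` D !=set0 -> C = D.
Proof.
move=> cC cD CD0; apply/seteqP; split; first exact: (sa_component_sub cC cD).
by apply: (sa_component_sub cD cC); rewrite setIC.
Qed.

Lemma has_b0_le (R : rcfType) (n : nat) (S : set 'rV[R]_n) (m k : nat) :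
  has_b0 S m -> has_b0 S k -> (m <= k)%N.
Proof.
move=> [C [cC dC _]] [D [cD _ SD]].
have CD i : exists j, C i = D j.
  have [[x Cx] _ _ [F _ CF] _] := cC i.
  have : S x by move: Cx; rewrite CF => -[].
  rewrite SD => -[j _ Dx]; exists j.
  by apply: (sa_component_eq (cC i) (cD j)); exists x.
have [f Cf] := choice CD.
have f_inj : injective f.
  move=> i j fij; apply: contrapT => /eqP /dC.
  rewrite !Cf fij setIid => D0.
  by have [[x]] := cD (f j); rewrite D0.
by have := leq_card f f_inj; rewrite !card_ord.
Qed.

Lemma has_b0_uniq (R : rcfType) (n : nat) (S : set 'rV[R]_n) (m k : nat) :
  has_b0 S m -> has_b0 S k -> m = k.
Proof.
by move=> Sm Sk; apply/eqP; rewrite eqn_leq !(@has_b0_le _ _ S).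
Qed.

(* Main.v *)
(* Components are counted through functions f that are locally constant on the
   set and constant along certain arcs.  Let F be multi-affine and write
   F = t A + B in a variable t with A = dF/dt not identically zero.

   The complement of Z(F) has at most 2^d regions: each point of {F > 0} can be
   moved slightly so that A <> 0, and then vertically to the graph F = 1, which
   lies over {A <> 0}; likewise for {F < 0} and F = -1.  As deg A <= d - 1, the
   count doubles with the degree.

   Over {A <> 0}, Z(F) is the graph of - B / A, so this part contributes at most
   2^(d-1) components.  A point p of Z(F) that is not a limit of that part can
   still be joined to it inside Z(F): some other variable s has points of Z(F)
   close to p with M = dF/ds <> 0, and there A = 0, so the discriminant
   F * (d^2 F/ds dt) - M A, which depends neither on s nor on t, vanishes near p
   and hence identically.  Thus F (d^2 F/ds dt) = M A, and one leaves along A = 0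
   in direction t until M = 0, then along M = 0 in direction s until A <> 0.

   The arcs needed are graphs over coordinate segments, hence rational curves;
   a semi-algebraic set meets such a curve in finitely many intervals. *)

Require Import Defs.
From HB Require Import structures.
From mathcomp Require Import all_boot all_order all_algebra.
From mathcomp Require Import mpoly.
From mathcomp Require Import boolp classical_sets.
From mathcomp Require Import topology_structure num_topology matrix_topology.
From mathcomp Require Import filter pseudometric_structure ring lra.

Set Implicit Arguments.
Unset Strict Implicit.
Unset Printing Implicit Defensive.

Import Order.TTheory GRing.Theory Num.Theory.
Import numFieldTopology.Exports.

Local Open Scope classical_set_scope.
Local Open Scope ring_scope.

(** * Limits along a filter, with values in [R] *)

Section Limits.
Variables (R : rcfType) (T : Type) (G : set_system T).
Context {FG : Filter G}.
Implicit Types (h k : T -> R) (a b : R).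

Definition tends h a := forall e, 0 < e -> G [set y | `|h y - a| < e].

Lemma tends_cst a : tends (fun=> a) a.
Proof. by move=> e e0; apply: filterS filterT => y _ /=; rewrite subrr normr0. Qed.

Lemma tendsD h k a b : tends h a -> tends k b -> tends (fun y => h y + k y) (a + b).
Proof.
move=> ha kb e e0.
have e2 : 0 < e / 2 by lra.
apply: filterS (filterI (ha _ e2) (kb _ e2)) => y /= [h1 k1].
have -> : h y + k y - (a + b) = (h y - a) + (k y - b) by ring.
by apply: le_lt_trans (ler_normD _ _) _; lra.
Qed.

Lemma tendsM h k a b : tends h a -> tends k b -> tends (fun y => h y * k y) (a * b).
Proof.
move=> ha kb e e0.
set C := 1 + `|a| + `|b|.
have C0 : 0 < C by rewrite /C; have := normr_ge0 a; have := normr_ge0 b; lra.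
set d := Num.min 1 (e / 2 / C).
have d0 : 0 < d by rewrite lt_min ltr01 /= divr_gt0 //; lra.
apply: filterS (filterI (ha _ d0) (kb _ d0)) => y /= [h1 k1].
have -> : h y * k y - a * b = (h y - a) * (k y - b) + (h y - a) * b + a * (k y - b)
  by ring.
apply: (@le_lt_trans _ _ (d * C)).
  apply: le_trans (ler_normD _ _) _; apply: le_trans (lerD (ler_normD _ _) (lexx _)) _.
  rewrite !normrM /C.
  have d1 : d <= 1 by rewrite ge_min lexx.
  have := normr_ge0 a; have := normr_ge0 b.
  have := normr_ge0 (h y - a); have := normr_ge0 (k y - b).
  by nra.
have : d * C <= e / 2 by rewrite -ler_pdivlMr // ge_min lexx orbT.
by lra.
Qed.

(** The sign of the product records both that [h y] is nonzero and that it has the sign of [a]. *)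
Lemma tends_neq0 h a : tends h a -> a != 0 -> G [set y | 0 < h y * a].
Proof.
move=> ha a0; have a1 : 0 < `|a| by rewrite normr_gt0.
apply: filterS (ha _ a1) => y /=; rewrite ltr_distl.
by case: (ltgtP a 0) a0 => // a2 _ /andP[]; [rewrite ltr0_norm|rewrite gtr0_norm]; nra.
Qed.

Lemma tendsV h a : tends h a -> a != 0 -> tends (fun y => (h y)^-1) a^-1.
Proof.
move=> ha a0 e e0; have a1 : 0 < `|a| by rewrite normr_gt0.
(* This radius keeps the absolute value of [h y] above half that of [a], which bounds the
   denominator [h y * a] away from 0. *)
have a2 : 0 < `|a| / 2 by lra.
have a3 : 0 < e * (`|a| * `|a| / 2) by rewrite mulr_gt0 // divr_gt0 ?mulr_gt0.
apply: filterS (filterI (filterI (tends_neq0 ha a0) (ha _ a2)) (ha _ a3)) => y /=.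
move=> [[hy0 hy1] hy2].
have hy : h y != 0 by apply/eqP => hy; move: hy0; rewrite hy mul0r ltxx.
have -> : (h y)^-1 - a^-1 = (a - h y) / (h y * a) by field; rewrite hy a0.
rewrite normrM normfV normrM distrC ltr_pdivrMr ?mulr_gt0 ?normr_gt0 //.
apply: lt_le_trans hy2 _; rewrite ler_pM2l //.
have : `|a| / 2 <= `|h y|; last by nra.
by have := ler_distD (h y) a 0; rewrite !subr0 distrC; lra.
Qed.

End Limits.

Lemma tends_horner (R : rcfType) (p : {poly R}) (u : R) :
  tends (nbhs u) (fun v => p.[v]) p.[u].
Proof.
have Xu : tends (nbhs u) id u.
  by move=> e e0; exists e => //= v; rewrite /= distrC.
elim/poly_ind: p => [|p c IHp].
  by under eq_fun do rewrite horner0; rewrite horner0; exact: tends_cst.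
rewrite hornerMXaddC; under eq_fun do rewrite hornerMXaddC.
by apply: tendsD; [exact: tendsM|exact: tends_cst].
Qed.

(** * Coordinate moves in [R^n] and the identity principle *)

Section Space.
Variables (R : rcfType) (n : nat).
Local Notation V := 'rV[R]_n.
Implicit Types (x y z p q : V) (i j s t : 'I_n) (F : V -> R).

Definition upd x i (u : R) : V := \row_j (if j == i then u else x 0 j).

Lemma updE x i u j : upd x i u 0 j = if j == i then u else x 0 j.
Proof. by rewrite mxE. Qed.

Lemma upd_upd x i u v : upd (upd x i u) i v = upd x i v.
Proof. by apply/rowP => j; rewrite !updE; case: eqP. Qed.

Lemma updC x i j u v : i != j -> upd (upd x i u) j v = upd (upd x j v) i u.
Proof.
move=> ij; apply/rowP => k; rewrite !updE.
by case: eqP => // ->; rewrite eq_sym (negbTE ij).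
Qed.

Lemma upd_id x i : upd x i (x 0 i) = x.
Proof. by apply/rowP => j; rewrite updE; case: eqP => // ->. Qed.

Definition box (e : R) p q := forall j, `|q 0 j - p 0 j| < e.

Lemma nbhs_boxP p (Q : set V) :
  nbhs p Q <-> exists2 e, 0 < e & forall q, box e p q -> Q q.
Proof.
split=> [/nbhs_ballP[e e0 eQ]|[e e0 eQ]].
  exists e => // q bq; apply: eQ; split=> // k j.
  by rewrite ord1 /ball /= distrC; exact: bq.
apply/nbhs_ballP; exists e => //= q [_ bq]; apply: eQ => j.
by rewrite distrC; exact: bq.
Qed.

Lemma tends_coord p j : tends (nbhs p) (fun x => x 0 j) (p 0 j).
Proof. by move=> e e0; apply/nbhs_boxP; exists e => // q; exact. Qed.

Lemma nbhs_row (T : Type) (G : set_system T) (FG : Filter G) (h : T -> V)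
    (p : V) (Q : set V) :
  (forall j, tends G (fun a => h a 0 j) (p 0 j)) -> nbhs p Q ->
  G [set a | Q (h a)].
Proof.
move=> hp /nbhs_boxP[e e0 eQ].
have := @filter_forall _ _ (fun j a => `|h a 0 j - p 0 j| < e) G FG
  (fun j => hp j e e0).
by apply: filterS => a ?; apply: eQ.
Qed.

Lemma nbhs_upd (h : V -> R) p i (Q : set V) :
  tends (nbhs p) h (h p) -> nbhs (upd p i (h p)) Q ->
  nbhs p [set x | Q (upd x i (h x))].
Proof.
move=> hh; apply: nbhs_row => j; rewrite updE; under eq_fun do rewrite updE.
by case: eqP => // _; exact: tends_coord.
Qed.

(** The walk changes one coordinate at a time. The condition on [z] confines it to any box about [p]
    that contains [q]. *)
Lemma path_ind (Q : V -> Prop) p q : Q p ->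
  (forall z i, (forall j, z 0 j = p 0 j \/ z 0 j = q 0 j) -> Q z ->
    Q (upd z i (q 0 i))) -> Q q.
Proof.
move=> Qp Qupd; pose z k : V := \row_j (if (j < k)%N then q 0 j else p 0 j).
have zn : z n = q by apply/rowP => j; rewrite mxE ltn_ord.
rewrite -zn; have : (n <= n)%N by [].
elim: {1 3}n => [|k IHk] kn.
  by rewrite (_ : z 0%N = p) //; apply/rowP => j; rewrite mxE.
have -> : z k.+1 = upd (z k) (Ordinal kn) (q 0 (Ordinal kn)).
  apply/rowP => j; rewrite updE !mxE ltnS leq_eqVlt.
  rewrite -[j == Ordinal kn]val_eqE /=.
  by have [jk /=|//] := eqVneq (j : nat) k; congr (q 0 _); exact: val_inj.
apply: Qupd; last exact/IHk/ltnW.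
by move=> j; rewrite mxE; case: ifP => _; [right|left].
Qed.

Definition polynomial_in_each F :=
  forall x i, exists r : {poly R}, forall u, F (upd x i u) = r.[u].

Lemma poly_eq0_near (r : {poly R}) (a e : R) : 0 < e ->
  (forall u, `|u - a| < e -> r.[u] = 0) -> r = 0.
Proof.
move=> e0 re; apply/eqP; apply: contraT => r0.
(* These give [size r] distinct roots, one more than the degree; starting at [k.+2] keeps their
   distance to [a] below [e]. *)
pose c k := a + e / k.+2%:R.
pose rs := mkseq c (size r).
have : (size rs < size r)%N.
  apply: max_poly_roots => //; last first.
    apply/mkseq_uniqP => k l _ _ /addrI /(mulfI (lt0r_neq0 e0)) /invr_inj.
    by move/eqP; rewrite eqr_nat => /eqP [].
  apply/allP => u /mapP[k _ ->]; apply/eqP; apply: re.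
  rewrite /c addrC addKr gtr0_norm ?divr_gt0 ?ltr0n //.
  by rewrite ltr_pdivrMr ?ltr0n // ltr_pMr // ltr1n.
by rewrite size_mkseq ltnn.
Qed.

(** Vanishing on a box survives moving one coordinate of its centre, since a polynomial that
    vanishes on an interval is zero. Such moves carry the centre from [p] to [x]. *)
Lemma polynomial_in_each_eq0 F p (Q : set V) : polynomial_in_each F ->
  nbhs p Q -> (forall q, Q q -> F q = 0) -> forall x, F x = 0.
Proof.
move=> polF /nbhs_boxP[e e0 eQ] QF x.
suff : forall q, box e x q -> F q = 0.
  by apply=> j; rewrite subrr normr0.
apply: (@path_ind (fun z => forall q, box e z q -> F q = 0) p).
  by move=> q /eQ; exact: QF.
move=> z i _ Fz q bq; have [r rE] := polF q i.
rewrite -[q](upd_id q i) rE (@poly_eq0_near r (z 0 i) e) ?horner0 //.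
move=> u ue; rewrite -rE; apply: Fz => j; rewrite updE.
by have := bq j; rewrite updE; case: eqP => // ->.
Qed.

Lemma polynomial_in_each_dense F p (Q : set V) x : polynomial_in_each F ->
  F x != 0 -> nbhs p Q -> exists2 q, Q q & F q != 0.
Proof.
move=> polF Fx pQ; apply: contrapT => nQ.
move/eqP: Fx; apply; apply: (polynomial_in_each_eq0 polF pQ) => q Qq.
by apply: contrapT => /eqP Fq; apply: nQ; exists q.
Qed.

End Space.

(** * Regions of multi-affine functions *)

Section MultiAffine.
Variables (R : rcfType) (n : nat).
Local Notation V := 'rV[R]_n.
Implicit Types (x y z p q : V) (i j s t : 'I_n) (F : V -> R).

(* For [F] affine in the coordinate [i], this is the partial derivative. *)
Definition diff i F x : R := F (upd x i 1) - F (upd x i 0).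

Definition affine_in_each F :=
  forall x i u, F (upd x i u) = u * diff i F x + F (upd x i 0).

Definition multi_affine_fun F :=
  affine_in_each F /\ forall p, tends (nbhs p) F (F p).

(** For functions affine in each coordinate this is total degree at most [d], in the form used by
    induction on the degree. *)
Fixpoint degree_le d F : Prop :=
  if d is d'.+1 then forall i, degree_le d' (diff i F)
  else forall i x, diff i F x = 0.

Lemma diff_upd F i x u : diff i F (upd x i u) = diff i F x.
Proof. by rewrite /diff !upd_upd. Qed.

Lemma tends_upd F p i u : (forall q, tends (nbhs q) F (F q)) ->
  tends (nbhs p) (fun x => F (upd x i u)) (F (upd p i u)).
Proof.
move=> Fc e e0; apply: (@nbhs_upd _ _ (fun=> u) p i [set y | `|F y - F (upd p i u)| < e]).
  exact: tends_cst.
exact: Fc.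
Qed.

Lemma affineE F : affine_in_each F ->
  forall x i, F x = x 0 i * diff i F x + F (upd x i 0).
Proof. by move=> Fa x i; rewrite -{1}[x](upd_id x i) Fa. Qed.

Lemma multi_affine_diff F i : multi_affine_fun F -> multi_affine_fun (diff i F).
Proof.
move=> [Fa Fc]; split=> [x j u|p].
  have [<-|ij] := eqVneq i j.
    by rewrite {2}/diff !diff_upd subrr mulr0 add0r.
  rewrite [LHS]/diff [in X in _ * X]/diff.
  rewrite /diff !(updC _ _ _ (i := j) (j := i)) 1?eq_sym // !(Fa _ j u).
  rewrite /diff; ring.
rewrite /diff; apply: tendsD; first exact: tends_upd.
rewrite -mulN1r (_ : (fun x => _) = fun x => -1 * F (upd x i 0)).
  by apply: tendsM; [exact: tends_cst|exact: tends_upd].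
by apply/funext => x; rewrite mulN1r.
Qed.

Lemma affine_polynomial F : affine_in_each F -> polynomial_in_each F.
Proof.
move=> Fa x i; exists ((diff i F x)%:P * 'X + (F (upd x i 0))%:P) => u.
by rewrite !hornerE Fa mulrC.
Qed.

Lemma upd_const_on_path (T : Type) (f : V -> T) p :
  (forall x i u, f (upd x i u) = f x) -> forall q, f q = f p.
Proof. by move=> fu q; apply: (@path_ind _ _ (fun z => f z = f p) p) => // z i _ <-. Qed.

Definition locally_constant_on (T : Type) (S : set V) (f : V -> T) :=
  forall p, S p -> \forall q \near p, S q -> f q = f p.

(* The point where [F = c] on the line through [x] in direction [t]; junk when
   [diff t F x = 0]. *)
Definition level F t (c : R) x : V :=
  upd x t ((c - F (upd x t 0)) / diff t F x).

Lemma level_upd F t c x u : level F t c (upd x t u) = level F t c x.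
Proof. by rewrite /level !upd_upd diff_upd. Qed.

Lemma levelP F t c x : affine_in_each F -> diff t F x != 0 ->
  F (level F t c x) = c.
Proof. by move=> Fa A0; rewrite Fa divfK // subrK. Qed.

Lemma nbhs_level F t c p (Q : set V) : multi_affine_fun F ->
  diff t F p != 0 -> nbhs (level F t c p) Q -> nbhs p [set x | Q (level F t c x)].
Proof.
move=> Fma A0; have [Fa Fc] := Fma; apply: nbhs_upd.
apply: tendsM; last by apply: tendsV => //; exact: (multi_affine_diff t Fma).2.
apply: tendsD; first exact: tends_cst.
rewrite -mulN1r (_ : (fun x => _) = fun x => -1 * F (upd x t 0)).
  by apply: tendsM; [exact: tends_cst|exact: tends_upd].
by apply/funext => x; rewrite mulN1r.
Qed.

(** Over [diff t F x != 0] the set [F = c] is a graph, so labels on [S] pull back to a set defined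
    by a function of lower degree. *)
Lemma level_locally_constant (T : Type) F t c (S : set V) (f : V -> T) :
  multi_affine_fun F -> (forall x, F x = c -> S x) -> locally_constant_on S f ->
  locally_constant_on [set x | diff t F x != 0] (fun x => f (level F t c x)).
Proof.
move=> Fma cS fS p /= A0.
have FlS x : diff t F x != 0 -> S (level F t c x).
  by move=> Ax; apply/cS/levelP => //; exact: Fma.1.
apply: filterS (nbhs_level Fma A0 (fS _ (FlS _ A0))) => x /= h Ax.
exact/h/FlS.
Qed.

(** Far out in the direction given by the sign of [c * a], both affine functions of [u] take the
    sign of [c]; [k] is large enough for both. *)
Lemma common_height (a b a' b' c : R) : c != 0 -> 0 < a * a' ->
  exists u, 0 < c * (u * a + b) /\ 0 < c * (u * a' + b').
Proof.
move=> c0 aa'.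
have c2 : 0 < c * c by rewrite -expr2 exprn_even_gt0.
have a2 : 0 < a * a.
  by rewrite -expr2 exprn_even_gt0 //=; apply/eqP => a0; rewrite a0 mul0r ltxx in aa'.
set A := c * c * (a * a); set A' := c * c * (a * a').
have A0 : 0 < A by rewrite mulr_gt0.
have A'0 : 0 < A' by rewrite mulr_gt0.
set k := (`|c * b| + 1) / A + (`|c * b'| + 1) / A'.
have kA : `|c * b| + 1 <= k * A.
  by rewrite mulrDl divfK ?lt0r_neq0 // lerDl mulr_ge0 ?divr_ge0 ?addr_ge0 // ltW.
have kA' : `|c * b'| + 1 <= k * A'.
  by rewrite mulrDl divfK ?lt0r_neq0 // lerDr mulr_ge0 ?divr_ge0 ?addr_ge0 // ltW.
exists (c * a * k); split.
  rewrite (_ : _ * _ = k * A + c * b); last by rewrite /A; ring.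
  by have := ler_norm (- (c * b)); rewrite normrN; lra.
rewrite (_ : _ * _ = k * A' + c * b'); last by rewrite /A'; ring.
by have := ler_norm (- (c * b')); rewrite normrN; lra.
Qed.

(** Think of [f] as labelling regions: [F] is affine along a coordinate move, so equal signs at the
    ends keep the segment in one region. Counting labels lets the induction replace [f] by its
    pullback along [level F t c]. *)
Lemma nonvanishing_regions (T : eqType) d F (f : V -> T) :
  multi_affine_fun F -> degree_le d F -> (exists x, F x != 0) ->
  locally_constant_on [set x | F x != 0] f ->
  (forall x i u, 0 < F x * F (upd x i u) -> f x = f (upd x i u)) ->
  exists2 r : seq T, (size r <= 2 ^ d)%N & forall x, F x != 0 -> f x \in r.
Proof.
elim: d F f => [|d IHd] F f Fma degF [x0 Fx0] fF fstep; have [Fa Fc] := Fma.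
(* If all differences vanish, [F] is a nonzero constant and there is a single label; base case and
   induction step share this argument. *)
all: have [[t [x1 At]]|dF0] := pselect (exists t x, diff t F x != 0); last first.
1,3: have cF x i u : F (upd x i u) = F x.
1,3: have d0 : diff i F x = 0
  by apply: contrapT => /eqP D0; apply: dF0; exists i, x.
1,2: by rewrite Fa [RHS](affineE Fa x i) d0 !mulr0.
1,2: exists [:: f x0]; [by rewrite ?expn_gt0|move=> x _; rewrite inE; apply/eqP].
1,2: apply: upd_const_on_path => y i u; rewrite -fstep // cF.
1,2: by rewrite (upd_const_on_path x0 cF) -expr2 exprn_even_gt0.
  by rewrite /= in degF; rewrite degF eqxx in At.
have same_sign y z c : 0 < c * F y -> 0 < c * F z -> 0 < F y * F z.
  have := mulr_ge0 (normr_ge0 c) (normr_ge0 c); rewrite -normrM ger0_norm; nra.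
have Ama := multi_affine_diff t Fma.
have rangeE c : c != 0 -> exists2 r : seq T, (size r <= 2 ^ d)%N &
    forall x, diff t F x != 0 -> f (level F t c x) \in r.
  move=> c0; have c2 : 0 < c * c by rewrite -expr2 exprn_even_gt0.
  apply: (IHd (diff t F) (fun x => f (level F t c x))) => //; first by exists x1.
    by apply: level_locally_constant fF => // x /= ->.
  move=> x i u AA'.
  have [->|it] := eqVneq i t; first by rewrite level_upd.
  have [A0 A'0] : diff t F x != 0 /\ diff t F (upd x i u) != 0.
    by split; apply/eqP => A0; move: AA'; rewrite A0 ?mulr0 ?mul0r ltxx.
  (* Climb from the graph [F = c] to a height [v] with [c * F > 0] over both ends, cross there in
     direction [i], and descend again. *)
  have [v [v1 v2]] := common_height (F (upd x t 0)) (F (upd (upd x i u) t 0)) c0 AA'.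
  rewrite -!Fa in v1 v2.
  have climb y : diff t F y != 0 -> 0 < c * F (upd y t v) ->
      f (level F t c y) = f (upd y t v).
    move=> Ay cF.
    have Fl := levelP c Fa Ay.
    rewrite [RHS](_ : _ = f (upd (level F t c y) t v)); last by rewrite upd_upd.
    by apply: fstep; rewrite Fl upd_upd.
  rewrite climb // climb // updC //; apply: fstep; rewrite -updC //.
  exact: same_sign v1 v2.
have [r1 r1d r1P] := rangeE 1 (oner_neq0 R).
have [r2 r2d r2P] := rangeE (-1) ltac:(by rewrite oppr_eq0 oner_neq0).
exists (r1 ++ r2); first by rewrite size_cat expnS mul2n -addnn leq_add.
move=> p Fp; rewrite mem_cat.
have [q [FqFp fq] Aq] : exists2 q, 0 < F q * F p /\ (F q != 0 -> f q = f p)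
    & diff t F q != 0.
  apply: (polynomial_in_each_dense (affine_polynomial Ama.1) At).
  exact: filterI (tends_neq0 (Fc p) Fp) (fF _ Fp).
have Fq : F q != 0 by apply/eqP => Fq; rewrite Fq mul0r ltxx in FqFp.
rewrite -fq //.
have reach c : 0 < F q * c -> f q = f (level F t c q).
  by move=> Fc0; apply: fstep; rewrite (levelP _ Fa Aq).
by have [Fq0|Fq0|Fq0] := ltgtP (F q) 0; [rewrite (reach (-1)) ?r2P ?orbT //; lra|
  rewrite (reach 1) ?r1P //; lra|rewrite Fq0 eqxx in Fq].
Qed.

Lemma zero_reach_nonvanishing_diff (T : Type) F t (f : V -> T) x1 :
  multi_affine_fun F -> diff t F x1 != 0 ->
  locally_constant_on [set x | F x = 0] f ->
  (forall x i u, F x = 0 -> F (upd x i u) = 0 -> f x = f (upd x i u)) ->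
  forall p, F p = 0 -> exists q, [/\ F q = 0, diff t F q != 0 & f q = f p].
Proof.
move=> Fma A1 fF fstep p Fp; have [Fa Fc] := Fma.
have /nbhs_boxP[e e0 eP] := fF p Fp.
(* Otherwise every zero of [F] in the box has [A = 0], where [A] is [diff t F]; below, [M] is
   [diff s F]. *)
apply: contrapT => none.
have A0 q : box e p q -> F q = 0 -> diff t F q = 0.
  move=> bq Fq; apply: contrapT => /eqP Aq; apply: none; exists q; split=> //.
  exact: eP.
(* Walk inside the box from [p] to a point with [F <> 0]. A step from a zero of [F] whose partial
   derivative vanishes ends at a zero again, so some step has [M <> 0]. *)
have [p' [s [bp' Fp' Mp']]] : exists p' s, [/\ box e p p', F p' = 0 & diff s F p' != 0].
  have [x2 Fx2] : exists x2, F x2 != 0.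
    apply: contrapT => F0; move/eqP: A1; apply; rewrite /diff.
    have z y : F y = 0 by apply: contrapT => /eqP ?; apply: F0; exists y.
    by rewrite !z subrr.
  have [q bq Fq] := polynomial_in_each_dense (affine_polynomial Fa) Fx2
    (iffRL (nbhs_boxP p (box e p)) (ex_intro2 _ _ e e0 (fun q bq => bq))).
  apply: contrapT => no; move/eqP: Fq; apply.
  apply: (@path_ind _ _ (fun z => F z = 0) p) => // z i zpq Fz.
  have bz : box e p z.
    by move=> j; have [->|->] := zpq j; rewrite ?subrr ?normr0.
  have Mz : diff i F z = 0.
    by apply: contrapT => /eqP Mz; apply: no; exists z, i.
  rewrite Fa Mz mulr0 add0r; have := affineE Fa z i.
  by rewrite Fz Mz mulr0 add0r => <-.
have st : s != t by apply: contraNneq Mp' => ->; rewrite A0.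
have Ama := multi_affine_diff t Fma; have Aa := Ama.1.
have Mma := multi_affine_diff s Fma; have Ma := Mma.1.
pose a := diff s (diff t F).
have ama : multi_affine_fun a by exact: multi_affine_diff.
have aE : a = diff t (diff s F).
  apply/funext => x; rewrite /a /diff !(updC _ _ _ st); ring.
(* By [DE] below this is the discriminant [F * a - M * A], written so that it
   is visibly independent of [s]. *)
pose D x := F (upd x s 0) * a x - diff s F x * diff t F (upd x s 0).
have DE x : D x = F x * a x - diff s F x * diff t F x.
  by rewrite /D (affineE Fa x s) (affineE Aa x s) -/a; ring.
have lv0 : level F s 0 p' = p'.
  rewrite /level -[RHS](upd_id p' s); congr upd.
  by move: (affineE Fa p' s); rewrite Fp' => /esym/eqP; rewrite addr_eq0 => /eqP h;
    rewrite add0r -h mulfK.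
have near_level : \forall x \near p',
    diff s F x != 0 /\ (F (level F s 0 x) = 0 /\ box e p (level F s 0 x)
      /\ diff t F (level F s 0 x) = 0).
  have bnear : nbhs p' (box e p).
    apply/nbhs_boxP.
    exists (\big[Num.min/e]_j (e - `|p' 0 j - p 0 j|)).
      by rewrite lt_bigmin // => j _; rewrite subr_gt0.
    move=> q bq j; apply: le_lt_trans (ler_distD (p' 0 j) _ _) _.
    have := lt_le_trans (bq j) (bigmin_le_cond _ _ (isT : predT j)).
    by lra.
  rewrite -{1}lv0 in bnear.
  apply: filterS (filterI (tends_neq0 (Mma.2 p') Mp') (nbhs_level Fma Mp' bnear)).
  move=> x /= [Mx bx].
  have Mx0 : diff s F x != 0 by apply: contraTneq Mx => ->; rewrite mul0r ltxx.
  by split=> //; rewrite levelP //; do !split => //; apply: A0; rewrite ?levelP.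
(* Moving along [s] to the graph [F = 0] leaves [D] unchanged and reaches a point with [F = A = 0].
   So [D] vanishes near [p'], hence everywhere. *)
have D0 x : D x = 0.
  have polD : polynomial_in_each D.
    move=> y i.
    have [rF FE] := affine_polynomial Fa y i.
    have [ra aaE] := affine_polynomial ama.1 y i.
    have [rM ME] := affine_polynomial Ma y i.
    have [rA AE] := affine_polynomial Aa y i.
    by exists (rF * ra - rM * rA) => u; rewrite DE FE aaE ME AE !hornerE.
  apply: (polynomial_in_each_eq0 polD near_level) => y [My [Fly [_ Aly]]].
  have <- : D (level F s 0 y) = D y.
    by rewrite /D /level upd_upd /a !diff_upd.
  by rewrite DE Fly Aly mul0r mulr0 subr0.
(* If [a] were identically zero, [D = 0] would give [M * A = 0], but near [p'] there is a point with
   both factors nonzero. *)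
have [xa axa] : exists x, a x != 0.
  apply: contrapT => noa.
  have a0 x : a x = 0 by apply: contrapT => /eqP ax; apply: noa; exists x.
  have [q [Mq _] Aq] := polynomial_in_each_dense (affine_polynomial Aa) A1 near_level.
  have := DE q; rewrite D0 a0 mulr0 sub0r => /esym/eqP.
  by rewrite oppr_eq0 mulf_eq0 (negbTE Mq) (negbTE Aq).
have [x [Mx [Flx [blx Alx]]] ax] :=
  polynomial_in_each_dense (affine_polynomial ama.1) axa near_level.
(* The escape route: [q] to [q1] keeps [A = 0], [q1] to [q2] keeps [M = 0]. *)
set q := level F s 0 x in Flx blx Alx.
have aq : a q != 0 by rewrite /q /level /a diff_upd.
pose q1 := level (diff s F) t 0 q.
have Mq1 : diff s F q1 = 0 by apply: levelP => //; rewrite -aE.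
have aq1 : a q1 != 0 by rewrite /q1 /level aE diff_upd -aE.
have Fq1 : F q1 = 0.
  have := DE q1; rewrite D0 Mq1 mul0r subr0 => /esym/eqP.
  by rewrite mulf_eq0 (negbTE aq1) orbF => /eqP.
(* As [M = 0] at [q1], the line in direction [s] lies in the zero set; [A] has slope [a <> 0] on it
   and so takes the nonzero value 1. *)
pose q2 := level (diff t F) s 1 q1.
have Aq2 : diff t F q2 = 1 by apply: levelP.
have Fq2 : F q2 = 0.
  rewrite Fa Mq1 mulr0 add0r; have := affineE Fa q1 s.
  by rewrite Fq1 Mq1 mulr0 add0r => <-.
apply: none; exists q2; split=> //; first by rewrite Aq2 oner_neq0.
by rewrite -(fstep q1) // -(fstep q) //; exact: eP.
Qed.

(** The pullback of [f] to the graph over [diff t F x != 0] falls under [nonvanishing_regions] in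
    degree [d], and every zero shares its label with a point of that graph. The last hypothesis
    lifts moves to the graph; a move in direction [t] does not change the lift. *)
Lemma zero_regions (T : eqType) d F (f : V -> T) :
  multi_affine_fun F -> degree_le d.+1 F ->
  locally_constant_on [set x | F x = 0] f ->
  (forall x i u, F x = 0 -> F (upd x i u) = 0 -> f x = f (upd x i u)) ->
  (forall t x i u, i != t -> 0 < diff t F x * diff t F (upd x i u) ->
    f (level F t 0 x) = f (level F t 0 (upd x i u))) ->
  exists2 r : seq T, (size r <= 2 ^ d)%N & forall x, F x = 0 -> f x \in r.
Proof.
move=> Fma degF fF fstep flevel; have [Fa Fc] := Fma.
have [[t [x1 A1]]|dF0] := pselect (exists t x, diff t F x != 0).
  have [r rd rP] : exists2 r : seq T, (size r <= 2 ^ d)%N &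
      forall x, diff t F x != 0 -> f (level F t 0 x) \in r.
    apply: (@nonvanishing_regions _ d (diff t F) (fun x => f (level F t 0 x))) => //.
    - exact: multi_affine_diff.
    - by exists x1.
    - by apply: level_locally_constant fF => // x /= ->.
    move=> x i u AA'; have [->|it] := eqVneq i t; first by rewrite level_upd.
    exact: flevel.
  exists r => // p Fp.
  have [q [Fq Aq <-]] := zero_reach_nonvanishing_diff Fma A1 fF fstep Fp.
  by rewrite (fstep q t ((0 - F (upd q t 0)) / diff t F q)) ?rP //; exact: levelP.
have cF x i u : F (upd x i u) = F x.
  have d0 : diff i F x = 0.
    by apply: contrapT => /eqP D0; apply: dF0; exists i, x.
  by rewrite Fa [RHS](affineE Fa x i) d0 !mulr0.
exists [:: f 0]; first by rewrite expn_gt0.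
move=> x Fx; rewrite inE; apply/eqP.
by apply: upd_const_on_path => y i u; rewrite -fstep ?cF // (upd_const_on_path x cF).
Qed.

End MultiAffine.

(** * Semi-algebraic sets along rational curves *)

(** Multiplied by [a], both terms are nonnegative and one is positive. *)
Lemma convex_comb_neq0 (R : rcfType) (a b v : R) :
  0 < a * b -> 0 <= v <= 1 -> (1 - v) * a + v * b != 0.
Proof.
move=> ab /andP[v0 v1]; apply/eqP => h.
have a2 : 0 < a * a.
  by rewrite -expr2 exprn_even_gt0 //=; apply: contraTneq ab => ->; rewrite mul0r ltxx.
have : (1 - v) * (a * a) + v * (a * b) = 0 by rewrite -[RHS](mulr0 a) -h; ring.
have [v2|v2] := lerP v (1 / 2); last by have := mulr_gt0 (_ : 0 < v) ab; nra.
by nra.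
Qed.

Section Curves.
Variables (R : rcfType) (n : nat).
Local Notation V := 'rV[R]_n.
Implicit Types (N : 'I_n -> {poly R}) (D r : {poly R}) (u v w : R).

(** Division by zero yields 0, so statements about the curve suppose [D.[u] != 0]. *)
Definition curve N D u : V := \row_j ((N j).[u] / D.[u]).

(** Functions of the form [r / D ^+ k] are closed under sums and products, so [P] along the curve is
    one of them. *)
Lemma curve_numerator N D (P : {mpoly R[n]}) :
  exists r, forall u, D.[u] != 0 ->
    (0 < P.@[curve N D u 0]) = (0 < r.[u]) /\
    (P.@[curve N D u 0] == 0) = (r.[u] == 0).
Proof.
pose rational (h : R -> R) :=
  exists r k, forall u, D.[u] != 0 -> h u = r.[u] / D.[u] ^+ k.
have ratc c : rational (fun=> c).
  by exists c%:P, 0%N => u _; rewrite hornerC expr0 divr1.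
have ratM h k : rational h -> rational k -> rational (fun u => h u * k u).
  move=> [r [a hE]] [q [b kE]]; exists (r * q), (a + b)%N => u Du.
  by rewrite hE // kE // hornerM exprD; field; rewrite !expf_neq0.
have ratD h k : rational h -> rational k -> rational (fun u => h u + k u).
  move=> [r [a hE]] [q [b kE]].
  exists (r * D ^+ b + q * D ^+ a), (a + b)%N => u Du.
  by rewrite hE // kE // !hornerE exprD; field; rewrite !expf_neq0.
have ratV j : rational (fun u => curve N D u 0 j).
  by exists (N j), 1%N => u _; rewrite mxE expr1.
have ratX h k : rational h -> rational (fun u => h u ^+ k).
  move=> rh; elim: k => [|k IHk]; first exact: ratc.
  by under eq_fun do rewrite exprS; exact: ratM.
have [r [k rE]] : rational (fun u => P.@[curve N D u 0]).
  under eq_fun do rewrite mevalE.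
  elim: (msupp P : seq _) => [|m l IHl].
    by under eq_fun do rewrite big_nil; exact: ratc.
  under eq_fun do rewrite big_cons; apply: (ratD) => //; apply: (ratM) => //.
  elim: (index_enum _) => [|j e IHe].
    by under eq_fun do rewrite big_nil; exact: ratc.
  by under eq_fun do rewrite big_cons; apply: (ratM) => //; exact: ratX.
(* The extra factor makes the power of [D] even, so that it does not affect
   the sign. *)
exists (r * D ^+ k) => u Du; rewrite rE // hornerM horner_exp.
have Dk : D.[u] ^+ k != 0 by rewrite expf_neq0.
have Dk2 : 0 < D.[u] ^+ k * D.[u] ^+ k by rewrite -expr2 exprn_even_gt0.
rewrite (_ : r.[u] * D.[u] ^+ k = r.[u] / D.[u] ^+ k * (D.[u] ^+ k * D.[u] ^+ k)).
  by rewrite (pmulr_lgt0 _ Dk2) !mulf_eq0 invr_eq0 (negbTE Dk) !orbF.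
by rewrite mulrA divfK.
Qed.

Lemma root_free_sign r u v : u < v -> (forall w, u <= w <= v -> r.[w] != 0) ->
  (0 < r.[u]) = (0 < r.[v]).
Proof.
move=> uv r0.
have ru : r.[u] != 0 by apply: r0; rewrite lexx ltW.
have rv : r.[v] != 0 by apply: r0; rewrite lexx ltW.
apply/idP/idP => [ru0|rv0]; rewrite ltNge; apply/negP => le0.
  have [|w uwv] := @poly_ivt _ (- r) u v (ltW uv).
    by rewrite !hornerN oppr_ge0 oppr_le0 le0 ltW.
  by rewrite rootN => /rootP rw; have := r0 w uwv; rewrite rw eqxx.
have [|w uwv /rootP rw] := @poly_ivt _ r u v (ltW uv); first by rewrite le0 ltW.
by have := r0 w uwv; rewrite rw eqxx.
Qed.

(** Where [D] is nonzero, the finitely many polynomial conditions that define [E] change their truth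
    value only at roots of their numerators; [q] collects these. *)
Lemma semialgebraic_curve N D (E : set V) : semialgebraic E ->
  exists2 q : {poly R}, q != 0 & forall u v, u < v ->
    (forall w, u <= w <= v -> q.[w] != 0 /\ D.[w] != 0) ->
    E (curve N D u) <-> E (curve N D v).
Proof.
elim=> [P|P|A B _ [q q0 qA] _ [r r0 rB]|A _ [q q0 qA]].
1,2: have [r rP] := curve_numerator N D P.
(* A zero numerator makes the condition constant; 1 then keeps [q] nonzero. *)
1,2: exists (if r == 0 then 1 else r).
1,3: by case: ifP => [_|/negbT//]; exact: oner_neq0.
1,2: move=> u v uv qD /=.
1,2: have [Du Dv] : D.[u] != 0 /\ D.[v] != 0.
1,3: by split; apply qD; rewrite lexx ltW.
1,2: have [rPu rPu0] := rP u Du; have [rPv rPv0] := rP v Dv.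
1,2: have [r0|r0] := eqVneq r 0.
- by split=> _; apply/eqP; rewrite ?rPu0 ?rPv0 r0 horner0.
- rewrite (negbTE r0) in qD; have [] := qD u; first by rewrite lexx ltW.
  have [] := qD v; first by rewrite lexx ltW.
  by move=> rv _ ru _; split=> /eqP; rewrite ?rPu0 ?rPv0 ?(negbTE ru) ?(negbTE rv).
- by rewrite rPu rPv r0 !horner0.
- rewrite (negbTE r0) in qD; rewrite rPu rPv (root_free_sign uv) // => w /qD.
  by case.
- exists (q * r); first by rewrite mulf_neq0.
  move=> u v uv qrD.
  have h w : u <= w <= v -> [/\ q.[w] != 0, r.[w] != 0 & D.[w] != 0].
    by move=> /qrD[]; rewrite hornerM mulf_eq0 negb_or => /andP[].
  have Ah := qA u v uv (fun w uwv => let: And3 a b c := h w uwv in conj a c).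
  have Bh := rB u v uv (fun w uwv => let: And3 a b c := h w uwv in conj b c).
  by rewrite /setU /=; tauto.
- by exists q => // u v uv /(qA u v uv) h; rewrite /setC /=; tauto.
Qed.

Definition clopen_in (S E : set V) :=
  forall p, S p -> \forall q \near p, S q -> (E q <-> E p).

(** Intervals of [R] may be disconnected in the order topology, so finiteness of the possible
    changes is essential. Cutting at a root [w] of [q] removes a factor; once the interior has no
    root, local constancy is used at the two ends only. *)
Lemma locally_constant_itv (C : set R) (q : {poly R}) a b : q != 0 -> a <= b ->
  (forall u v, a < u -> u < v -> v < b ->
     (forall w, u <= w <= v -> q.[w] != 0) -> C u <-> C v) ->
  (forall u, a <= u <= b -> \forall v \near u, a <= v <= b -> (C v <-> C u)) ->
  C a <-> C b.
Proof.
have [m] := ubnP (size q); elim: m q a b => // m IHm q a b qm q0 ab qC Cloc.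
have [<- //|ab_neq] := eqVneq a b.
have {ab_neq} ltab : a < b by rewrite lt_neqAle ab_neq.
have [[w awb qw]|noroot] := pselect (exists2 w, a < w < b & q.[w] = 0).
  have [aw wb] := andP awb.
  have [q1 qE] := factor_theorem q w (introT rootP qw).
  have q10 : q1 != 0 by apply: contraNneq q0 => q10; rewrite qE q10 mul0r.
  have sq1 : (size q1 < m)%N.
    by move: qm; rewrite qE size_Mmonic ?monicXsubC // size_XsubC addn2.
  have qneq0 v : v != w -> q1.[v] != 0 -> q.[v] != 0.
    by move=> vw q1v; rewrite qE hornerM mulf_neq0 // hornerXsubC subr_eq0.
  apply: (@iff_trans _ (C w)); apply: (IHm q1) => //; try exact: ltW.
  - move=> u v au uv vw q1w; apply: qC => //; first exact: lt_trans wb.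
    by move=> z uzv; apply: qneq0; [apply/eqP; lra|exact: q1w].
  - move=> u awu; have abu : a <= u <= b by lra.
    by apply: filterS (Cloc u abu) => v h awv; apply: h; lra.
  - move=> u v wu uv vb q1w; apply: qC => //; first exact: lt_trans wu.
    by move=> z uzv; apply: qneq0; [apply/eqP; lra|exact: q1w].
  - move=> u wub; have abu : a <= u <= b by lra.
    by apply: filterS (Cloc u abu) => v h wvb; apply: h; lra.
have [e1 /= e10 C1] := Cloc a ltac:(lra).
have [e2 /= e20 C2] := Cloc b ltac:(lra).
(* A third of [e] puts [a + e / 3] before [b - e / 3], each close enough to its end. *)
pose e := Num.min (Num.min e1 e2) (b - a).
have e0 : 0 < e by rewrite !lt_min e10 e20 subr_gt0.
have [ee1 ee2 eba] : [/\ e <= e1, e <= e2 & e <= b - a].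
  by rewrite !ge_min !lexx !orbT.
have {}C1 : C (a + e / 3) <-> C a.
  by apply: C1 => /=; [rewrite opprD addNKr normrN gtr0_norm|]; lra.
have {}C2 : C (b - e / 3) <-> C b.
  by apply: C2 => /=; [rewrite opprB addrCA subrr addr0 gtr0_norm|]; lra.
rewrite -C1 -C2; apply: qC; try lra.
by move=> w uwv; apply/eqP => qw; apply: noroot; exists w => //; lra.
Qed.

(** This stands in for connectedness of the arc. *)
Lemma clopen_curve N D (S E : set V) : semialgebraic E -> clopen_in S E ->
  (forall u, 0 <= u <= 1 -> D.[u] != 0 /\ S (curve N D u)) ->
  E (curve N D 0) <-> E (curve N D 1).
Proof.
move=> sE cE DS; have [q q0 qE] := semialgebraic_curve N D sE.
apply: (@locally_constant_itv (fun u => E (curve N D u)) q) => //.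
- move=> u v u0 uv v1 qw; apply: qE => // w uwv; split; first exact: qw.
  by apply: (DS w _).1; lra.
move=> u u01; have [Du Su] := DS u u01.
have cont j : tends (nbhs u) (fun v => curve N D v 0 j) (curve N D u 0 j).
  rewrite mxE; under eq_fun do rewrite mxE.
  by apply: tendsM; [exact: tends_horner|apply: tendsV => //; exact: tends_horner].
apply: filterS (nbhs_row _ cont (cE _ Su)) => v /= h v01.
by apply: h; exact: (DS v v01).2.
Qed.

End Curves.

(** * Polynomial functions *)

Section MpolyFunctions.
Variables (R : rcfType) (n : nat).
Local Notation V := 'rV[R]_n.
Implicit Types (x y p q : V) (F G : V -> R) (A : {set 'I_n}).

Definition mono (A : {set 'I_n}) x : R := \prod_(j in A) x 0 j.

Lemma mono_upd A x i u :
  mono A (upd x i u) = if i \in A then u * mono (A :\ i) x else mono A x.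
Proof.
rewrite /mono; case: ifPn => iA.
  rewrite (big_setD1 i) //= updE eqxx; congr (_ * _).
  by apply: eq_bigr => j; rewrite !inE updE => /andP[/negbTE->].
apply: eq_bigr => j jA; rewrite updE; case: eqP => // ji.
by rewrite -ji jA in iA.
Qed.

Lemma diff_mono A i :
  diff i (mono A) = if i \in A then mono (A :\ i) else fun=> 0.
Proof.
apply/funext => x; rewrite /diff !mono_upd; case: ifP => _; last by rewrite subrr.
by rewrite mul1r mul0r subr0.
Qed.

Lemma degree_le0 d : degree_le d (fun _ : V => 0 : R).
Proof.
elim: d => [|d IHd] i /=; first by move=> x; rewrite /diff subrr.
by rewrite (_ : diff i _ = fun=> 0) //; apply/funext => x; rewrite /diff subrr.
Qed.

Lemma degree_leDZ d F G c :
  degree_le d F -> degree_le d G -> degree_le d (fun x => c * F x + G x).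
Proof.
have dE i (F' G' : V -> R) : diff i (fun x => c * F' x + G' x) =
    fun x => c * diff i F' x + diff i G' x.
  by apply/funext => x; rewrite /diff; ring.
elim: d F G => [|d IHd] F G dF dG i /=; last by rewrite dE; exact: IHd.
by move=> x; rewrite dE dF dG mulr0 addr0.
Qed.

Lemma degree_le_mono d A : (#|A| <= d)%N -> degree_le d (mono A).
Proof.
elim: d A => [|d IHd] A Ad i; rewrite diff_mono; case: ifPn => iA //.
- by move: Ad; rewrite (cardsD1 i A) iA.
- by apply: IHd; move: Ad; rewrite (cardsD1 i A) iA.
- exact: degree_le0.
Qed.

Lemma multi_affine_mono A : multi_affine_fun (mono A).
Proof.
split=> [x i u|p].
  rewrite diff_mono !mono_upd; case: ifP => _; last by rewrite mulr0 add0r.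
  by rewrite mul0r addr0.
rewrite /mono; elim: (index_enum _) => [|j e IHe].
  by under eq_fun do rewrite big_nil; rewrite big_nil; exact: tends_cst.
under eq_fun do rewrite big_cons; rewrite big_cons; case: ifP => // _.
by apply: tendsM => //; exact: tends_coord.
Qed.

Lemma multi_affine_funDZ F G c : multi_affine_fun F -> multi_affine_fun G ->
  multi_affine_fun (fun x => c * F x + G x).
Proof.
move=> [Fa Fc] [Ga Gc]; split=> [x i u|p].
  by rewrite Fa Ga /diff; ring.
by apply: tendsD => //; apply: tendsM => //; exact: tends_cst.
Qed.

(** The exponents are 0 or 1, so each monomial is [mono A] for the set [A] of its variables, and
    both properties pass to linear combinations. For nonzero [P], [msize] is the degree plus one. *)
Lemma multi_affine_mpoly (P : {mpoly R[n]}) d : multi_affine P ->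
  (msize P <= d.+1)%N ->
  multi_affine_fun (fun x => P.@[x 0]) /\ degree_le d (fun x => P.@[x 0]).
Proof.
move=> Pma Pd.
have msuppP m : m \in msupp P -> exists2 A : {set 'I_n}, (#|A| <= d)%N &
    forall x, \prod_j x 0 j ^+ m j = mono A x.
  move=> mP; have m1 j : (m j <= 1)%N.
    by apply: leq_trans (Pma j); rewrite /partial_deg (big_rem m) //= leq_maxl.
  have mE j : m j = (m j == 1%N) by case: (m j) (m1 j) => [|[|]].
  exists [set j | m j == 1%N]%SET.
    rewrite -ltnS; apply: leq_trans Pd; apply: leq_ltn_trans (msize_mdeg_lt mP).
    rewrite mdegE -sum1_card big_mkcond /=; apply: leq_sum => j _.
    by rewrite inE {2}mE; case: eqP.
  move=> x; rewrite /mono [RHS]big_mkcond; apply: eq_bigr => j _.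
  by rewrite inE {1}mE; case: eqP.
under eq_fun do rewrite mevalE; elim: (msupp P : seq _) msuppP => [|m l IHl] lP.
  under eq_fun do rewrite big_nil.
  split; last exact: degree_le0.
  split=> [x i u|p]; first by rewrite /diff subrr mulr0 addr0.
  exact: tends_cst.
have [A Ad AE] := lP m (mem_head _ _).
have [|lma ld] := IHl; first by move=> m' m'l; apply: lP; rewrite inE m'l orbT.
under eq_fun do rewrite big_cons AE; split.
  by apply: multi_affine_funDZ => //; exact: multi_affine_mono.
by apply: degree_leDZ => //; exact: degree_le_mono.
Qed.

End MpolyFunctions.

(** * Components *)

Section Components.
Variables (R : rcfType) (n : nat).
Local Notation V := 'rV[R]_n.
Implicit Types (S : set V).

(** This is [has_b0] without connectedness of the pieces; a partition with the most pieces recovers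
    it. *)
Definition clopen_partition S m (C : 'I_m -> set V) :=
  [/\ forall i, [/\ C i !=set0, semialgebraic (C i), closed_in S (C i)
        & open_in S (C i)],
      forall i j, i != j -> C i `&` C j = set0
    & S = \bigcup_i C i].

(** Each half of a disconnected piece is open in [S] because the other half is closed in that
    piece. *)
Lemma clopen_partition_split S m (C : 'I_m -> set V) i :
  clopen_partition S C -> ~ sa_connected (C i) ->
  exists C' : 'I_m.+1 -> set V, clopen_partition S C'.
Proof.
move=> [CP Cdisj SE] /contrapT[A [B [[sA sB] [A0 B0] [clA clB] AB0 CiE]]].
have [_ _ [K clK CiK] [U opU CiU]] := CP i.
have sub X Y : C i = X `|` Y -> X `&` Y = set0 -> closed_in (C i) X ->
    closed_in (C i) Y -> closed_in S X /\ open_in S X.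
  move=> XY XY0 [F clF XF] [G clG YG]; split.
    by exists (K `&` F); [exact: closedI|rewrite setIA -CiK].
  exists (U `&` ~` G); first by apply: openI => //; exact: closed_openC.
  rewrite setIA -CiU; apply/seteqP; split=> [x Xx|x [Cx nGx]].
    have Cx : C i x by rewrite XY; left.
    split=> // Gx; have XYx : (X `&` Y) x by split=> //; rewrite YG.
    by rewrite XY0 in XYx.
  have : (X `|` Y) x by rewrite -XY.
  by case=> // Yx; move: Yx; rewrite YG => -[].
have [clSA opSA] := sub A B CiE AB0 clA clB.
have [clSB opSB] : closed_in S B /\ open_in S B.
  by apply: (sub B A) => //; rewrite 1?setUC 1?setIC.
(* The new last index carries [B]; old indices keep their pieces, except that [i] receives [A]. *)
exists (fun k => if unlift ord_max k is Some j then (if j == i then A else C j) else B).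
have AC : A `<=` C i by rewrite CiE => x; left.
have BC : B `<=` C i by rewrite CiE => x; right.
split=> [k|k l|].
- by case: unliftP => [j|] _ //; case: eqP => [_|_] //; exact: CP.
- case: unliftP => [j ->|->]; case: unliftP => [h ->|->]; last by rewrite eqxx.
  + rewrite (inj_eq lift_inj) => jh.
    have := Cdisj _ _ jh; rewrite -!subset0 => CC x [].
    by case: eqP => [ji|_] => [/AC|] xj; case: eqP => [hi|_] => [/AC|] xh;
      apply: (CC x); rewrite ?ji ?hi.
  + move=> _; case: eqP => [_ //|/eqP ji].
    have := Cdisj _ _ ji; rewrite -!subset0 => CC x [Cx /BC Bx].
    exact: (CC x).
  + move=> _; case: eqP => [_ |/eqP ji]; first by rewrite setIC.
    have := Cdisj _ _ ji; rewrite -!subset0 => CC x [/BC Bx Cx].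
    exact: (CC x).
apply/seteqP; split=> x.
  rewrite SE => -[j _ Cx]; have [ji|ji] := eqVneq j i.
    move: Cx; rewrite ji CiE => -[Ax|Bx].
      by exists (lift ord_max i) => //=; rewrite liftK eqxx.
    by exists ord_max => //=; rewrite unlift_none.
  by exists (lift ord_max j) => //=; rewrite liftK (negbTE ji).
move=> [k _]; case: unliftP => [j|] _.
  by case: eqP => _ Cx; rewrite SE; [exists i => //; exact: AC|exists j].
by move=> /BC Bx; rewrite SE; exists i.
Qed.

(** The bound provides a partition with the largest number of pieces, and these cannot be split
    further. *)
Lemma has_b0_exists S k : semialgebraic S ->
  (forall m (C : 'I_m -> set V), clopen_partition S C -> (m <= k)%N) ->
  exists2 b, has_b0 S b & (b <= k)%N.
Proof.
move=> sS bound.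
pose part m := `[< exists C : 'I_m -> set V, clopen_partition S C >].
have partk m : part m -> (m <= k)%N by move=> /asboolP[C /bound].
have ex_part : exists m, part m.
  (* Pieces are nonempty, so the empty set takes the partition with no pieces. *)
  have [S0|/set0P S0] := eqVneq S set0.
    exists 0%N; apply/asboolP; exists (fun=> set0); split=> [[]//|[]//|].
    by rewrite S0; apply/seteqP; split=> // x [[]].
  exists 1%N; apply/asboolP; exists (fun=> S); split=> [_|i j|].
  - split=> //; first by exists setT; rewrite ?setIT; first exact: closedT.
    by exists setT; rewrite ?setIT; first exact: openT.
  - by rewrite !ord1 eqxx.
  - by apply/seteqP; split=> x; [exists 0|case].
have [m /asboolP[C CP] mmax] := ex_maxnP ex_part partk.
have [Ci Cdisj SE] := CP.
exists m; last by apply: (bound m C).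
exists C; split=> // i; have [? ? ? ?] := Ci i; split=> //.
apply: contrapT => /(clopen_partition_split CP) /asboolP /mmax.
by rewrite ltnn.
Qed.

Lemma clopen_partition_clopen S m (C : 'I_m -> set V) i :
  clopen_partition S C -> clopen_in S (C i).
Proof.
move=> [/(_ i)[_ _ [F clF CF] [U opU CU]] _ _] p Sp.
have [Cp|nCp] := pselect (C i p).
  have Up : nbhs p U by apply: open_nbhs_nbhs; split=> //; move: Cp; rewrite CU => -[].
  by apply: filterS Up => q Uq Sq; split=> // _; rewrite CU.
have nFp : nbhs p (~` F).
  apply: open_nbhs_nbhs; split; first exact: closed_openC.
  by move=> Fp; apply: nCp; rewrite CF.
by apply: filterS nFp => q nFq Sq; split=> //; rewrite CF => -[].
Qed.

End Components.

Theorem theorem2 (R : rcfType) (d n : nat) (hd : (1 <= d)%N) (hn : (1 <= n)%N)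
    (P : {mpoly R[n]}) (hP : multi_affine P) (hdeg : (msize P <= d.+1)%N) :
  exists2 b : nat, has_b0 (zero_set P) b & (b <= 2 ^ (d - 1))%N.
Proof.
case: d hd hdeg => // d _ hdeg; rewrite subn1 /=.
have [Pma Pdeg] := multi_affine_mpoly hP hdeg.
pose F (x : 'rV[R]_n) := P.@[x 0]; have Fa : affine_in_each F := Pma.1.
apply: has_b0_exists; first exact: semialgebraic_eq0.
move=> m C CP; have [Ci Cdisj SE] := CP.
(* The label is the index of the piece containing [x], or [None] off the zero set. All [m] indices
   occur as labels, so bounding the labels bounds [m]. *)
pose f x : option 'I_m := [pick i | `[< C i x >]].
have fE x i : C i x -> f x = Some i.
  move=> Cx; rewrite /f; case: pickP => [j /asboolP Cj|/(_ i)/asboolP//].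
  congr Some; apply: contrapT => /eqP /Cdisj ij.
  by have : (C j `&` C i) x by []; rewrite ij.
have fC x y : zero_set P x -> (forall i, C i x -> C i y) -> f x = f y.
  by rewrite SE => -[i _ Cx] xy; rewrite (fE x i) // (fE y i) //; exact: xy.
have fcurve N D : (forall u : R, 0 <= u <= 1 ->
    D.[u] != 0 /\ zero_set P (curve N D u)) ->
    f (curve N D 0) = f (curve N D 1).
  move=> DS; apply: fC; first by apply: (DS 0 _).2; rewrite lexx ler01.
  move=> i; have [_ sCi _ _] := Ci i.
  exact: (clopen_curve sCi (clopen_partition_clopen i CP) DS).1.
have [r rd rP] : exists2 r : seq (option 'I_m), (size r <= 2 ^ d)%N &
    forall x, F x = 0 -> f x \in r.
  apply: zero_regions => //.
  - move=> p Sp; have : zero_set P p by []; rewrite SE => -[i _ Cp].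
    apply: filterS (clopen_partition_clopen i CP Sp) => q h Sq.
    by rewrite (fE p i) // (fE q i) //; apply/h.
  - move=> x i u Fx Fxu; have [->|ux] := eqVneq u (x 0 i); first by rewrite upd_id.
    (* [F] is affine on this line and has two zeros there, so the segment lies in the zero set; it
       is a curve with denominator 1. *)
    have Fline v : F (upd x i v) = 0.
      have d0 : (u - x 0 i) * diff i F x = 0.
        by have := affineE Fa x i; move: Fxu; rewrite Fx (Fa x i u) mulrBl; lra.
      have {}d0 : diff i F x = 0.
        by apply/eqP; move/eqP: d0; rewrite mulf_eq0 subr_eq0 (negbTE ux).
      by move: Fxu; rewrite (Fa x i u) (Fa x i v) d0 !mulr0.
    pose N j : {poly R} :=
      if j == i then (x 0 i)%:P + (u - x 0 i)%:P * 'X else (x 0 j)%:P.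
    have NE v : curve N 1 v = upd x i (x 0 i + (u - x 0 i) * v).
      by apply/rowP => j; rewrite !mxE /N; case: eqP => _; rewrite !hornerE divr1.
    have := fcurve N 1; rewrite !NE mulr0 addr0 upd_id mulr1 addrC subrK; apply.
    by move=> v _; rewrite hornerC oner_neq0 NE; split=> //; exact: Fline.
  move=> t x i u it AA'.
  have [rA rAE] := affine_polynomial (multi_affine_diff t Pma).1 x i.
  have [rB rBE] := affine_polynomial Fa (upd x t 0) i.
  pose L : {poly R} := (x 0 i)%:P + (u - x 0 i)%:P * 'X.
  pose D := rA \Po L.
  (* This is the arc of the graph of [- B / A] over the segment: [D] is [A] along it, coordinate [t]
     has numerator [- B], and the other coordinates carry a factor [D] that cancels. *)
  pose N j := if j == t then - (rB \Po L)
    else (if j == i then L else (x 0 j)%:P) * D.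
  have DE v : D.[v] = diff t F (upd x i L.[v]) by rewrite horner_comp rAE.
  have NE v : D.[v] != 0 -> curve N D v = level F t 0 (upd x i L.[v]).
    move=> Dv; apply/rowP => j; rewrite /level updE mxE -DE sub0r updC // rBE.
    rewrite /N; case: eqP => _; first by rewrite hornerN horner_comp.
    by rewrite hornerM mulfK // updE; case: eqP => _; rewrite ?hornerC.
  have L0 : L.[0] = x 0 i by rewrite /L !hornerE.
  have L1 : L.[1] = u.
    by rewrite /L hornerD hornerM !hornerC hornerX mulr1 addrC subrK.
  (* [A] is affine along the segment, so its values are convex combinations of two end values of the
     same sign. *)
  have Dneq0 v : 0 <= v <= 1 -> D.[v] != 0.
    have Aa := (multi_affine_diff t Pma).1.
    move=> v01.
    have AE : diff t F (upd x i L.[v]) =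
        (1 - v) * diff t F x + v * diff t F (upd x i u).
      rewrite (Aa x i L.[v]) (Aa x i u) [in RHS](affineE Aa x i).
      rewrite hornerD hornerM !hornerC hornerX.
      set a := diff i _ _; set b := diff t F _; set c := x 0 i.
      by clearbody a b c; ring.
    by rewrite DE AE; exact: convex_comb_neq0.
  have := fcurve N D; rewrite !NE ?Dneq0 ?lexx ?ler01 // L0 L1 upd_id; apply.
  move=> v v01; split; first exact: Dneq0.
  rewrite NE ?Dneq0 //; apply: (@levelP _ _ F t 0 (upd x i L.[v])) => //.
  by rewrite -DE Dneq0.
have fsurj i : Some i \in r.
  have [[x Cx] _ _ _] := Ci i; rewrite -(fE x i Cx); apply: rP.
  by have : zero_set P x by rewrite SE; exists i.
have sizem : size (map Some (enum 'I_m)) = m by rewrite size_map size_enum_ord.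
apply: leq_trans rd; apply: leq_trans (eq_leq (esym sizem)) _.
apply: uniq_leq_size; first by rewrite (map_inj_uniq (@Some_inj _)) enum_uniq.
by move=> _ /mapP[i _ ->].
Qed.
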